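(* There is an absolute constant $c>0$ such that the following holds. Let $n\ge1$, $k\ge 2$, and let $\nu$ be a probability distribution on $[k]$. Let $\Pi$ be a deterministic $[c_1,\ldots,c_k]$-bounded $k$-party protocol which solves unique set-disjointness under input distribution $\mathcal{D}_\nu$ with error at most $2\%$. Then $$\sum_{i\in[k]}\frac{c_i}{\nu(i)}\ \ge\ c\,n,$$ with the conventions $0/0=0$ and $a/0=+\infty$ for $a>0$.
   Context: Inputs are $X=(X_1,\ldots,X_k)\in(\{0,1\}^n)^k$, player $i$ holding $X_i$; $X^j=(X_1(j),\ldots,X_k(j))$ and $|X^j|$ is its Hamming weight. $\mathcal{F}_0=\{X:\forall j,\ |X^j|\le1\}$, $\mathcal{F}_1=\{X:\exists j,\ |X^j|=k,\ \forall j'\ne j,\ |X^{j'}|\le 1\}$; the correct output on $\mathcal{F}_b$ is $b$. Protocols are in the blackboard model (at each step a player determined by the current transcript writes a bit depending on its input and the transcript; the output bit is determined by the transcript). A protocol is $[c_1,\ldots,c_k]$-bounded if in every transcript player $i$ writes at most $c_i$ bits. It solves the problem under an input distribution $\mu$ (a distribution over pairs $(b,X)$ with $X\in\mathcal{F}_b$) with error $\delta$ if its output equals $b$ with probability at least $1-\delta$. Distribution $\mathcal{D}^0_\nu$: sample $W\in[k]^n$ with i.i.d. coordinates $W_j\sim\nu$; for each $j$, if $W_j=i$ then $X_i(j)\in\{0,1\}$ is a uniform bit and $X_{i'}(j)=0$ for $i'\ne i$. Distribution $\mathcal{D}^1_\nu$: sample $X\sim\mathcal{D}^0_\nu$, a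 uniform $j^*\in[n]$, and replace column $X^{j^*}$ by $1^k$. $\mathcal{D}_\nu$: sample a uniform bit $b$ and $X\sim\mathcal{D}^b_\nu$. *)

(* Defs.v *)
From HB Require Import structures.
From mathcomp Require Import all_boot all_order all_algebra.
From mathcomp Require Import Rstruct.
Set Implicit Arguments. Unset Strict Implicit. Unset Printing Implicit Defensive.
Import Order.TTheory GRing.Theory Num.Theory.
Local Open Scope ring_scope.

Notation Rr := Rdefinitions.R.

Definition pinput (n : nat) := {ffun 'I_n -> bool}.
Definition input (n k : nat) := {ffun 'I_k -> pinput n}.

(* Deterministic blackboard protocol tree: at a node, the player [i]
   (determined by the transcript so far, i.e. the position in the tree)
   writes the bit [f X_i]; the protocol continues in the subtree for that bit.
   At a leaf, the output bit is fixed (determined by the transcript). *)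
Inductive protocol (n k : nat) : Type :=
  | Leaf of bool
  | Node of 'I_k & (pinput n -> bool) & protocol n k & protocol n k.

Fixpoint pout (n k : nat) (p : protocol n k) (X : input n k) : bool :=
  match p with
  | Leaf b => b
  | Node i f t0 t1 => if f (X i) then pout t1 X else pout t0 X
  end.

Fixpoint pcost (n k : nat) (p : protocol n k) (X : input n k) (i : 'I_k) : nat :=
  match p with
  | Leaf _ => 0
  | Node j f t0 t1 =>
      (j == i) + (if f (X j) then pcost t1 X i else pcost t0 X i)
  end.

Definition bounded (n k : nat) (p : protocol n k) (c : 'I_k -> nat) : Prop :=
  forall (X : input n k) (i : 'I_k), (pcost p X i <= c i)%N.

Definition is_distr (k : nat) (nu : 'I_k -> Rr) : Prop :=
  (forall i, 0 <= nu i) /\ \sum_(i < k) nu i = 1.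

(* The input of D^0_nu determined by W in [k]^n and the uniform bits Y *)
Definition X0 (n k : nat) (W : {ffun 'I_n -> 'I_k}) (Y : {ffun 'I_n -> bool})
  : input n k := [ffun i => [ffun j => (W j == i) && Y j]].

Definition X1 (n k : nat) (W : {ffun 'I_n -> 'I_k}) (Y : {ffun 'I_n -> bool})
  (jstar : 'I_n) : input n k :=
  [ffun i => [ffun j => if j == jstar then true else (W j == i) && Y j]].

Definition wWY (n k : nat) (nu : 'I_k -> Rr) (W : {ffun 'I_n -> 'I_k})
  (Y : {ffun 'I_n -> bool}) : Rr :=
  (\prod_(j < n) nu (W j)) * (2 ^+ n)^-1.

(* Probability over (b, X) ~ D_nu that the protocol outputs b *)
Definition success_prob (n k : nat) (nu : 'I_k -> Rr) (p : protocol n k) : Rr :=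
  2^-1 * (\sum_(W : {ffun 'I_n -> 'I_k}) \sum_(Y : {ffun 'I_n -> bool})
            wWY nu W Y * (~~ pout p (X0 W Y))%:R)
  + 2^-1 * (\sum_(W : {ffun 'I_n -> 'I_k}) \sum_(Y : {ffun 'I_n -> bool})
            \sum_(jstar < n)
            wWY nu W Y * (n%:R)^-1 * (pout p (X1 W Y jstar))%:R).

(* Main.v *)
Require Import Defs.
From HB Require Import structures.
From mathcomp Require Import all_boot all_order all_algebra.
From mathcomp Require Import Rstruct.
From mathcomp Require Import reals sequences exp.
From mathcomp Require Import ring lra.
Set Implicit Arguments. Unset Strict Implicit. Unset Printing Implicit Defensive.
Import Order.TTheory GRing.Theory Num.Theory.
Local Open Scope ring_scope.

(* Fix W and a column j, and let P_S be the law of the transcript when column j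
   is the indicator of the set S of players and the other columns follow D^0
   given W. A successful protocol separates P_0 from P_[k] for most (W, j). The
   rectangle property makes P_S(t) a product over the players, so disjoint S, T
   satisfy the cut-and-paste identity P_S P_T = P_0 P_(S u T); hence, by
   doubling the density of a random set of players (Jayram's argument),
   h^2(P_0, P_[k]) <= 4 \sum_i h^2(P_0, P_{i}). In turn h^2(P_0, P_{i}) is at
   most the mean squared bias of the bit Y_j given the transcript when W_j = i.
   If mu is the measure of player i's side of the rectangle, these squared
   biases sum over j to at most 6 ln (1 / mu) (level-one inequality), and the
   mean of ln (1 / mu) is at most c_i because player i writes at most c_i bits.
   Resampling W_j turns the condition W_j = i into the factor 1 / nu(i). *)

(** The constant [M] is uniform in [p], so that [hell_product_le] can divide by [p] and let [p] tend
    to 0. *)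
Lemma prod_first_order (R : realFieldType) (I : eqType) (a d : I -> R) (s : seq I) :
  uniq s -> exists M : R, forall p, 0 <= p <= 1 ->
    `|\prod_(i <- s) (a i + p * d i)
      - (\prod_(i <- s) a i
         + p * \sum_(i <- s) d i * \prod_(l <- s | l != i) a l)| <= p ^+ 2 * M.
Proof.
elim: s => [|x s IHs] /=.
  by move=> _; exists 0 => p _; rewrite !big_nil mulr0 addr0 subrr normr0 mulr0.
move=> /andP[xs us]; have [M HM] := IHs us.
have Dx : \sum_(i <- x :: s) d i * (\prod_(l <- x :: s | l != i) a l) =
    d x * \prod_(i <- s) a i + a x * \sum_(i <- s) d i * \prod_(l <- s | l != i) a l.
  rewrite big_cons big_cons eqxx /= big_distrr /=; congr (_ * _ + _).
    rewrite big_seq_cond [RHS]big_seq; apply: eq_bigl => i.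
    by case: (boolP (i \in s)) => //= si; apply: contraNneq xs => <-.
  rewrite big_seq [RHS]big_seq; apply: eq_bigr => i si.
  rewrite big_cons ifT; last by apply: contraNneq xs => ->.
  by rewrite mulrCA.
set A := \prod_(i <- s) a i in HM Dx *.
set D := \sum_(i <- s) _ in HM Dx *.
exists (`|d x * D| + `|a x| * M + `|d x| * M) => p Hp.
rewrite Dx !big_cons -/A.
have /= := HM p Hp; set P := \prod_(i <- s) _ => HP.
have -> : (a x + p * d x) * P - (a x * A + p * (d x * A + a x * D)) =
  p ^+ 2 * (d x * D) + (a x + p * d x) * (P - (A + p * D)) by ring.
apply: (le_trans (ler_normD _ _)).
rewrite [X in X + _ <= _]normrM [X in _ + X <= _]normrM.
have p0 : 0 <= p by case/andP: Hp.
have p1 : p <= 1 by case/andP: Hp.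
rewrite [`|p ^+ 2|]ger0_norm ?sqr_ge0// -addrA mulrDr lerD2l -mulrDl mulrCA.
apply: ler_pM => //; apply: (le_trans (ler_normD _ _)).
by rewrite lerD2l normrM (ger0_norm p0) ler_piMl.
Qed.

(** * Squared Hellinger distances between product-form transcript laws *)

Section ProductHellinger.
Variables (R : realType) (T : Type) (k : nat) (s : seq T).
Variables a b : T -> 'I_k -> R.
Hypothesis a_ge0 : forall t i, 0 <= a t i.
Hypothesis b_ge0 : forall t i, 0 <= b t i.
Hypothesis mix1 : forall p : 'I_k -> R,
  \sum_(t <- s) \prod_i ((1 - p i) * a t i + p i * b t i) = 1.

Let g t i := Num.sqrt (a t i) * Num.sqrt (b t i).

(* Expected squared Hellinger distance between [P_0] and [P_A], where every player
   belongs to [A] independently with probability [p]. *)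
Definition hell p := 1 - \sum_(t <- s) \prod_i ((1 - p) * a t i + p * g t i).

(* Random colouring [W] of the players by [N] colours: expand
   [0 <= E_W (\sum_c (sqrt P_{W^-1(c)} - sqrt P_0))^2]; the colour classes
   being disjoint, the cross terms are governed by cut-and-paste. *)
Lemma colour_ineq t (N : nat) (x := N%:R^-1 : R) : (0 < N)%N ->
  0 <= N%:R * (N%:R - 1) * \prod_i ((1 - 2 * x) * a t i + 2 * x * g t i)
     + N%:R * \prod_i ((1 - x) * a t i + x * b t i)
     - 2 * N%:R ^+ 2 * \prod_i ((1 - x) * a t i + x * g t i)
     + N%:R ^+ 2 * \prod_i a t i.
Proof.
move=> N0.
have N0R : N%:R != 0 :> R by rewrite pnatr_eq0 -lt0n.
pose v (c : 'I_N) (i : 'I_k) w := Num.sqrt (if w == c then b t i else a t i).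
pose V (c : 'I_N) (W : {ffun 'I_k -> 'I_N}) : R := \prod_i v c i (W i).
pose V0 : R := \prod_i Num.sqrt (a t i).
have avgE (F : 'I_k -> 'I_N -> R) :
    \sum_(W : {ffun 'I_k -> 'I_N}) x ^+ k * \prod_i F i (W i) = \prod_i (x * \sum_w F i w).
  rewrite -big_distrr /= big_split /= prodr_const card_ord; congr (_ * _).
  by rewrite bigA_distr_bigA.
have sqa i : Num.sqrt (a t i) * Num.sqrt (a t i) = a t i by rewrite -expr2 sqr_sqrtr.
have sqb i : Num.sqrt (b t i) * Num.sqrt (b t i) = b t i by rewrite -expr2 sqr_sqrtr.
have one (c : 'I_N) (u e : R) : x * (\sum_w (u + (w == c)%:R * e)) = u + x * e.
  rewrite big_split /= sumr_const card_ord (bigD1 c) //= eqxx mul1r big1.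
    by rewrite addr0 mulrDr -[u *+ N]mulr_natl mulrA mulVf // mul1r.
  by move=> w /negbTE ->; rewrite mul0r.
have E00 : V0 * V0 = \prod_i a t i.
  by rewrite -big_split; apply: eq_bigr => i _; rewrite /= sqa.
have E0 c : \sum_W x ^+ k * (V0 * V c W) = \prod_i ((1 - x) * a t i + x * g t i).
  have -> : \sum_W x ^+ k * (V0 * V c W) =
      \sum_(W : {ffun 'I_k -> 'I_N}) x ^+ k * \prod_i (Num.sqrt (a t i) * v c i (W i)).
    by apply: eq_bigr => W _; rewrite /V0 /V -big_split.
  rewrite (avgE (fun i w => Num.sqrt (a t i) * v c i w)); apply: eq_bigr => i _.
  rewrite (eq_bigr (fun w => a t i + (w == c)%:R * (g t i - a t i))).
    by rewrite one; ring.
  by move=> w _; rewrite /v; case: eqP => _; rewrite /= ?mul1r ?mul0r ?addr0 ?sqa // /g; ring.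
have E1 c : \sum_W x ^+ k * (V c W * V c W) = \prod_i ((1 - x) * a t i + x * b t i).
  have -> : \sum_W x ^+ k * (V c W * V c W) =
      \sum_(W : {ffun 'I_k -> 'I_N}) x ^+ k * \prod_i (v c i (W i) * v c i (W i)).
    by apply: eq_bigr => W _; rewrite /V0 /V -big_split.
  rewrite (avgE (fun i w => v c i w * v c i w)); apply: eq_bigr => i _.
  rewrite (eq_bigr (fun w => a t i + (w == c)%:R * (b t i - a t i))).
    by rewrite one; ring.
  move=> w _; rewrite /v; case: eqP => _; rewrite /= ?mul1r ?mul0r ?addr0 ?sqa ?sqb //; ring.
have E2 c c' : c != c' -> \sum_W x ^+ k * (V c W * V c' W) =
    \prod_i ((1 - 2 * x) * a t i + 2 * x * g t i).
  move=> cc'.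
  have -> : \sum_W x ^+ k * (V c W * V c' W) =
      \sum_(W : {ffun 'I_k -> 'I_N}) x ^+ k * \prod_i (v c i (W i) * v c' i (W i)).
    by apply: eq_bigr => W _; rewrite /V0 /V -big_split.
  rewrite (avgE (fun i w => v c i w * v c' i w)); apply: eq_bigr => i _.
  rewrite (eq_bigr (fun w => (a t i / 2 + (w == c)%:R * (g t i - a t i)) +
                             (a t i / 2 + (w == c')%:R * (g t i - a t i)))).
    by rewrite big_split /= mulrDr !one; field.
  move=> w _; rewrite /v; case: (eqVneq w c) => [->|_].
    by rewrite (negbTE cc') /= /g; field.
  by case: eqP => _ /=; rewrite ?sqa /g; field.
have -> : N%:R * (N%:R - 1) * \prod_i ((1 - 2 * x) * a t i + 2 * x * g t i)
     + N%:R * \prod_i ((1 - x) * a t i + x * b t i)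
     - 2 * N%:R ^+ 2 * \prod_i ((1 - x) * a t i + x * g t i)
     + N%:R ^+ 2 * \prod_i a t i =
  \sum_W x ^+ k * (\sum_c (V c W - V0)) ^+ 2.
  transitivity (\sum_(c : 'I_N) \sum_(c' : 'I_N)
     (\sum_W x ^+ k * (V c W * V c' W) - \sum_W x ^+ k * (V0 * V c W)
      - \sum_W x ^+ k * (V0 * V c' W) + V0 * V0)); last first.
    rewrite [RHS](eq_bigr (fun W => \sum_(c < N) \sum_(c' < N)
       (x ^+ k * (V c W * V c' W) - x ^+ k * (V0 * V c W)
      - x ^+ k * (V0 * V c' W) + x ^+ k * (V0 * V0)))); last first.
      move=> W _; rewrite expr2 big_distrl /= big_distrr /=; apply: eq_bigr => c _.
      rewrite big_distrr /= big_distrr /=; apply: eq_bigr => c' _; ring.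
    rewrite [RHS]exchange_big /=; apply: eq_bigr => c _.
    rewrite [RHS]exchange_big /=; apply: eq_bigr => c' _.
    rewrite [RHS]big_split /= -!sumrB; congr (_ + _).
    rewrite sumr_const card_ffun !card_ord -mulr_natl natrX mulrA -exprMn.
    by rewrite mulfV // expr1n mul1r.
  rewrite (eq_bigr (fun c : 'I_N => (N%:R - 1) * \prod_i ((1 - 2 * x) * a t i + 2 * x * g t i)
     + \prod_i ((1 - x) * a t i + x * b t i) -
      2 * N%:R * \prod_i ((1 - x) * a t i + x * g t i) + N%:R * \prod_i a t i)).
    by rewrite sumr_const card_ord -[_ *+ N]mulr_natl; ring.
  move=> c _; rewrite (bigD1 c) //= E1 !E0 E00.
  rewrite [X in _ + X = _](eq_bigr (fun _ => \prod_i ((1 - 2 * x) * a t i + 2 * x * g t i) -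
     2 * \prod_i ((1 - x) * a t i + x * g t i) + \prod_i a t i)).
    rewrite (eq_bigl (fun i => i \in predC1 c)) // sumr_const cardC1 card_ord.
    have NE : N.-1%:R = N%:R - 1 :> R by rewrite -[N in RHS](prednK N0) -natr1 addrK.
    rewrite -[_ *+ N.-1]mulr_natl NE; ring.
  by move=> c' cc'; rewrite E2 1?eq_sym // !E0; ring.
apply: sumr_ge0 => W _; apply: mulr_ge0; last exact: sqr_ge0.
by rewrite exprn_ge0 // invr_ge0.
Qed.

Let mix (p : R) : \sum_(t <- s) \prod_i ((1 - p) * a t i + p * b t i) = 1.
Proof. exact: (mix1 (fun=> p)). Qed.

(** Sum [colour_ineq] over the transcripts: the products without [g] have total mass 1 by [mix1], so
    only [hell] at 1/N and 2/N is left. *)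
Lemma hell_double (N : nat) : (0 < N)%N ->
  (N%:R - 1) * hell (2 / N%:R) <= 2 * N%:R * hell (N%:R^-1).
Proof.
move=> N0; have := mix N%:R^-1; have := mix 0; rewrite /hell.
set S2 := \sum_(t <- s) \prod_i ((1 - 2 / _) * _ + _).
set S1 := \sum_(t <- s) \prod_i ((1 - _) * _ + _ * g _ _).
rewrite (eq_bigr (fun t => \prod_i a t i)); last first.
  by move=> t _; apply: eq_bigr => i _; ring.
move=> H0 HN.
have NR : 0 < N%:R :> R by rewrite ltr0n.
rewrite -(ler_pM2l NR) -subr_ge0.
have -> : N%:R * (2 * N%:R * (1 - S1)) - N%:R * ((N%:R - 1) * (1 - S2)) =
   N%:R * (N%:R - 1) * S2 + N%:R * 1 - 2 * N%:R ^+ 2 * S1 + N%:R ^+ 2 * 1 by ring.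
have : 0 <= \sum_(t <- s) (N%:R * (N%:R - 1) * (\prod_i ((1 - 2 / N%:R) * a t i + 2 / N%:R * g t i))
     + N%:R * (\prod_i ((1 - N%:R^-1) * a t i + N%:R^-1 * b t i))
     - 2 * N%:R ^+ 2 * (\prod_i ((1 - N%:R^-1) * a t i + N%:R^-1 * g t i))
     + N%:R ^+ 2 * \prod_i a t i).
  by apply: sumr_ge0 => t _; apply: colour_ineq.
by rewrite !big_split /= sumrN -!big_distrr /= H0 HN.
Qed.

(** Each halving, in the form [(1 - q) * hell (2 * q) <= 2 * hell q], loses a factor [1 - q]. The
    extra [p / 2] absorbs these losses: [(1 - q) * (1/4 + q) >= 1/4 + q / 2] for [q <= 1/4]. *)
Lemma hell_dyadic (m : nat) (p := (2 ^+ m.+1)^-1 : R) : 0 <= hell 1 ->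
  (4^-1 + p / 2) * p * hell 1 <= hell p.
Proof.
rewrite /p {p} => h1; elim: m => [|m].
  have := @hell_double 2 isT; rewrite divff ?pnatr_eq0 // expr1.
  by lra.
have := @hell_double (2 ^ m.+2) (expn_gt0 2 _); rewrite natrX.
have [q [q0 q1 -> -> ->]] : exists q : R, [/\ 0 < q, q <= 4^-1,
    2 ^+ m.+2 = q^-1, 2 ^- m.+1 = 2 * q & 2 ^- m.+2 = q].
  exists (2 ^- m.+2); split=> //; first by rewrite invr_gt0 exprn_gt0.
  - rewrite lef_pV2 ?posrE ?exprn_gt0 // !exprS mulrA -natrM -[leLHS]mulr1 ler_pM2l //.
    by rewrite exprn_ege1 // ler1n.
  - by rewrite invrK.
  - by rewrite [2 ^+ m.+2]exprS invfM mulrA mulfV ?pnatr_eq0 // mul1r.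
move=> H1 H2.
have H3 : (1 - q) * hell (2 * q) <= 2 * hell q.
  have qn0 : q != 0 by rewrite gt_eqF.
  have -> : (1 - q) * hell (2 * q) = q * ((q^-1 - 1) * hell (2 * q)) by field.
  have -> : 2 * hell q = q * (2 * q^-1 * hell q) by field.
  by rewrite ler_pM2l.
have H4 : 0 <= q * hell 1 * (q * (4^-1 - q)).
  by apply: mulr_ge0; apply: mulr_ge0; lra.
have H5 : (1 - q) * ((4^-1 + q) * (2 * q) * hell 1) <= (1 - q) * hell (2 * q).
  by apply: ler_wpM2l; lra.
lra.
Qed.

Let sum_one i : \sum_(t <- s) (\prod_(l | l != i) a t l) * b t i = 1.
Proof.
rewrite -[RHS](mix1 (fun l => (l == i)%:R)); apply: eq_bigr => t _.
rewrite [RHS](bigD1 i) //= eqxx subrr mul0r add0r mul1r mulrC; congr (_ * _).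
by apply: eq_bigr => l /negbTE ->; rewrite subr0 mul1r mul0r addr0.
Qed.

Let sum_zero : \sum_(t <- s) \prod_i a t i = 1.
Proof.
rewrite -[RHS](mix 0); apply: eq_bigr => t _; apply: eq_bigr => i _; ring.
Qed.

(** To first order in [p] at most one player belongs to the random set, so the derivative of [hell]
    at 0 is the sum over [i] of the squared Hellinger distances between P_0 and P_{i}. *)
Lemma hell_first_order : exists M : R, forall p, 0 <= p <= 1 ->
  hell p <= p * (2^-1 * \sum_i \sum_(t <- s)
    (\prod_(l | l != i) a t l) * (Num.sqrt (a t i) - Num.sqrt (b t i)) ^+ 2)
  + p ^+ 2 * M.
Proof.
have H t : exists M, forall p, 0 <= p <= 1 ->
   \prod_i a t i + p * \sum_i (g t i - a t i) * \prod_(l | l != i) a t l - p ^+ 2 * M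
   <= \prod_i ((1 - p) * a t i + p * g t i).
  have [M HM] := prod_first_order (a t) (fun i => g t i - a t i) (index_enum_uniq 'I_k).
  exists M => p Hp; move: (HM p Hp); rewrite ler_norml => /andP[H _].
  rewrite [X in _ <= X](eq_bigr (fun i => a t i + p * (g t i - a t i))); last first.
    by move=> i _; ring.
  by move: H; rewrite -subr_ge0 opprK => H; rewrite -subr_ge0; apply: le_trans H _;
    rewrite le_eqVlt; apply/orP; left; apply/eqP; ring.
have [M HM] : exists M, forall p, 0 <= p <= 1 ->
   \sum_(t <- s) (\prod_i a t i
      + p * \sum_i (g t i - a t i) * \prod_(l | l != i) a t l) - p ^+ 2 * M
   <= \sum_(t <- s) \prod_i ((1 - p) * a t i + p * g t i).
  elim: s => [|t s' [M IH]].
    by exists 0 => p _; rewrite !big_nil mulr0 subrr.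
  have [M' HM'] := H t; exists (M' + M) => p Hp.
  rewrite !big_cons; have := IH p Hp; have := HM' p Hp; lra.
exists M => p Hp; rewrite /hell; have := HM p Hp.
rewrite big_split /= sum_zero -big_distrr /= exchange_big /=.
have -> : \sum_i \sum_(t <- s) (g t i - a t i) * (\prod_(l | l != i) a t l) =
   - (2^-1 * \sum_i \sum_(t <- s)
    (\prod_(l | l != i) a t l) * (Num.sqrt (a t i) - Num.sqrt (b t i)) ^+ 2).
  rewrite big_distrr /= -sumrN; apply: eq_bigr => i _.
  have E1 := sum_one i.
  have E0 : \sum_(t <- s) (\prod_(l | l != i) a t l) * a t i = 1.
    by rewrite -[RHS]sum_zero; apply: eq_bigr => t _; rewrite [RHS](bigD1 i) // mulrC.
  (* Here [a - g = (sqrt a - sqrt b)^2 / 2 + (a - b) / 2], and the last term sums to 0 because P_0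
     and P_{i} both have mass 1. *)
  transitivity (- (2^-1 * \sum_(t <- s)
    (\prod_(l | l != i) a t l) * (Num.sqrt (a t i) - Num.sqrt (b t i)) ^+ 2)
     + 2^-1 * (\sum_(t <- s) (\prod_(l | l != i) a t l) * b t i
     - \sum_(t <- s) (\prod_(l | l != i) a t l) * a t i)); last first.
    by rewrite E0 E1 subrr mulr0 addr0.
  rewrite -sumrB !big_distrr /= -sumrN -big_split /=; apply: eq_bigr => t _.
  have := sqr_sqrtr (a_ge0 t i); have := sqr_sqrtr (b_ge0 t i); rewrite /g.
  by move: (Num.sqrt _) (Num.sqrt _) => v u <- <-; field.
lra.
Qed.

(** Divide [p * hell 1 / 4 <= hell p <= p * h / 2 + p ^+ 2 * M] by [p = 2 ^- m.+1] and let [m]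
    grow. *)
Lemma hell_product_le :
  1 - \sum_(t <- s) \prod_i (Num.sqrt (a t i) * Num.sqrt (b t i)) <=
  2 * \sum_i \sum_(t <- s)
    (\prod_(l | l != i) a t l) * (Num.sqrt (a t i) - Num.sqrt (b t i)) ^+ 2.
Proof.
have -> : 1 - \sum_(t <- s) \prod_i (Num.sqrt (a t i) * Num.sqrt (b t i)) = hell 1.
  rewrite /hell; congr (1 - _); apply: eq_bigr => t _; apply: eq_bigr => i _.
  by rewrite subrr mul0r add0r mul1r.
have [M HM] := hell_first_order.
set h := \sum_i _ in HM *.
have h0 : 0 <= h.
  apply: sumr_ge0 => i _; apply: sumr_ge0 => t _.
  by rewrite mulr_ge0 ?sqr_ge0 // prodr_ge0.
have [h1|/ltW h1] := leP 0 (hell 1); last by apply: le_trans h1 _; lra.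
rewrite leNgt; apply/negP => lt.
pose e := hell 1 - 2 * h.
have e0 : 0 < e by rewrite subr_gt0.
(* Then [2 ^ m.+1] exceeds [4 * |M| / e], so the quadratic error cannot fill the gap [e]. *)
pose m := Num.bound (4 * `|M| / e).
have Hm := hell_dyadic m h1.
have p0 : 0 < 2 ^- m.+1 :> R by rewrite invr_gt0 exprn_gt0.
have p1 : 2 ^- m.+1 <= 1 :> R by rewrite invf_le1 ?exprn_gt0 // exprn_ege1 // ler1n.
have := HM (2 ^- m.+1); rewrite p1 ltW // => /(_ isT) Hp.
have pM : 2 ^- m.+1 * (4 * `|M|) < e.
  rewrite mulrC ltr_pdivrMr ?exprn_gt0 // -ltr_pdivrMl // mulrC.
  apply: (lt_trans (archi_boundP _)); first by rewrite divr_ge0 ?mulr_ge0 // ltW.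
  by rewrite -natrX ltr_nat (ltn_trans (ltnSn _)) // ltn_expl.
set p := 2 ^- m.+1 in Hm p0 p1 Hp pM.
have ph : 0 <= p * p * hell 1 by apply: mulr_ge0 => //; apply: mulr_ge0; exact: ltW.
have MM : M <= `|M| := ler_norm M.
have : p * (hell 1 / 4) <= p * (2^-1 * h + p * `|M|).
  have : p ^+ 2 * M <= p ^+ 2 * `|M| by rewrite ler_wpM2l // sqr_ge0.
  by lra.
rewrite ler_pM2l // => H; move: pM; rewrite /e; lra.
Qed.
End ProductHellinger.

(** * Uniform averages over finite types *)

Section Average.
Variable R : realType.

(** The weight stays inside the sum, so that an average is by conversion one of the weighted sums of
    [leaves_sum]. *)
Definition avg (T : finType) (f : T -> R) : R := \sum_x #|T|%:R^-1 * f x.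

Lemma avgD (T : finType) (f g : T -> R) : avg (fun x => f x + g x) = avg f + avg g.
Proof. by rewrite -big_split; apply: eq_bigr => x _; rewrite mulrDr. Qed.

Lemma avgZ (T : finType) (c : R) (f : T -> R) : avg (fun x => c * f x) = c * avg f.
Proof. by rewrite /avg big_distrr /=; apply: eq_bigr => x _; rewrite mulrCA. Qed.

Lemma avg_sum (T : finType) (I : Type) (r : seq I) (P : pred I) (f : I -> T -> R) :
  avg (fun x => \sum_(i <- r | P i) f i x) = \sum_(i <- r | P i) avg (f i).
Proof. by rewrite [RHS]exchange_big; apply: eq_bigr => x _; rewrite big_distrr. Qed.

Lemma eq_avg (T : finType) (f g : T -> R) : f =1 g -> avg f = avg g.
Proof. by move=> fg; apply: eq_bigr => x _; rewrite fg. Qed.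

Lemma ler_avg (T : finType) (f g : T -> R) : (forall x, f x <= g x) -> avg f <= avg g.
Proof. by move=> fg; apply: ler_sum => x _; rewrite ler_wpM2l ?invr_ge0. Qed.

Lemma avg_ge0 (T : finType) (f : T -> R) : (forall x, 0 <= f x) -> 0 <= avg f.
Proof. by move=> f0; apply: sumr_ge0 => x _; rewrite mulr_ge0 ?invr_ge0. Qed.

Lemma avg_const (T : finType) (c : R) : (0 < #|T|)%N -> avg (fun _ : T => c) = c.
Proof.
move=> T0; rewrite /avg sumr_const -mulrnAl -[_^-1 *+ _]mulr_natl mulfV ?mul1r //.
by rewrite pnatr_eq0 -lt0n.
Qed.

Lemma sum_avg_weight (T : finType) : (0 < #|T|)%N -> \sum_(x : T) #|T|%:R^-1 = 1 :> R.
Proof. by move=> /(avg_const 1) {2}<-; apply: eq_bigr => x _; rewrite mulr1. Qed.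

Lemma avg_prod (I T : finType) (F : I -> T -> R) :
  avg (fun f : {ffun I -> T} => \prod_i F i (f i)) = \prod_i avg (F i).
Proof.
rewrite /avg bigA_distr_bigA; apply: eq_bigr => f _.
by rewrite big_split prodr_const card_ffun natrX exprVn.
Qed.

Lemma avg_inj (T : finType) (h : T -> T) (f : T -> R) :
  injective h -> avg (fun x => f (h x)) = avg f.
Proof. by move=> hI; rewrite [RHS](reindex_inj hI). Qed.

Lemma avg_exchange (S T : finType) (f : S -> T -> R) :
  avg (fun x => avg (f x)) = avg (fun y => avg (f^~ y)).
Proof.
rewrite /avg; under eq_bigr => x _ do rewrite big_distrr.
rewrite exchange_big; apply: eq_bigr => y _.
by rewrite big_distrr; apply: eq_bigr => x _; rewrite /= mulrCA.
Qed.

End Average.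

(** * The level-one inequality on the cube *)

Section LevelOne.
Variables (R : realType) (n : nat).
Implicit Types (A : pred {ffun 'I_n -> bool}) (j : 'I_n).

Definition density A : R := avg (fun Y => (A Y)%:R).
Definition fourier1 A j : R := avg (fun Y => (A Y)%:R * (-1) ^+ Y j).

Lemma ffun_bool_gt0 : (0 < #|{ffun 'I_n -> bool}|)%N.
Proof. by rewrite card_ffun card_bool expn_gt0. Qed.

Lemma density_ge0 A : 0 <= density A.
Proof. by apply: avg_ge0 => Y; apply: ler0n. Qed.

Lemma fourier1_le A j : `|fourier1 A j| <= density A.
Proof.
apply: le_trans (ler_norm_sum _ _ _) _; apply: ler_sum => Y _.
by rewrite !normrM normrX normrN1 expr1n mulr1 !ger0_norm ?invr_ge0.
Qed.

(** The bounds [expR y <= (1 - y)^-1] at [x] and [- x] average to [(1 - x^2)^-1], which is at most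
    [1 + 4/3 * x^2] when [x^2 <= 1/4]. The range of [x] is why [level_one] uses the weights
    [x_j / 2]. *)
Lemma cosh_le (x : R) : `|x| <= 2^-1 -> (expR x + expR (- x)) / 2 <= expR (4 / 3 * x ^+ 2).
Proof.
rewrite ler_norml => /andP[xl xr].
have bound (y : R) : y < 1 -> expR y <= (1 - y)^-1.
  move=> y1; rewrite -[leLHS]invrK -expRN lef_pV2 ?posrE ?expR_gt0 ?subr_gt0 //.
  exact: expR_ge1Dx.
have B1 : expR x <= (1 - x)^-1 by apply: bound; lra.
have B2 : expR (- x) <= (1 + x)^-1 by rewrite -[x in leRHS]opprK; apply: bound; lra.
apply: le_trans (_ : 1 + 4 / 3 * x ^+ 2 <= _); last exact: expR_ge1Dx.
apply: le_trans (_ : ((1 - x)^-1 + (1 + x)^-1) / 2 <= _); first by rewrite ler_pM2r ?invr_gt0 ?ltr0n ?lerD.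
have -> : ((1 - x)^-1 + (1 + x)^-1) / 2 = (1 - x ^+ 2)^-1.
  by field; apply/and3P; split; apply/eqP; nra.
have x2 : x ^+ 2 <= 4^-1 by nra.
have x20 : 0 <= x ^+ 2 by apply: sqr_ge0.
rewrite -[leLHS]mul1r ler_pdivrMr; nra.
Qed.

(* Exponential moment of [\sum_j (x_j / 2) s_j], [x_j] the bias of coordinate
   [j] on [A]: at most [expR (\sum_j x_j ^ 2 / 3)] on the whole cube, while
   Jensen on [A] alone gives at least [density A * expR (\sum_j x_j ^ 2 / 2)]. *)
Lemma level_one A : 0 < density A ->
  density A * expR ((\sum_j (fourier1 A j / density A) ^+ 2) / 6) <= 1.
Proof.
set mu := density A => mu0; pose x j := fourier1 A j / mu.
have mun0 : mu != 0 by rewrite gt_eqF.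
have x1 j : `|x j| <= 1.
  rewrite /x normrM normfV (gtr0_norm mu0) ler_pdivrMr // mul1r.
  exact: fourier1_le.
set S := \sum_j _.
have upper : avg (fun Y : {ffun 'I_n -> bool} => expR (\sum_j x j / 2 * (-1) ^+ Y j)) <= expR (S / 3).
  rewrite (eq_avg (g := fun Y : {ffun 'I_n -> bool} => \prod_j expR (x j / 2 * (-1) ^+ Y j))).
    rewrite (avg_prod (fun j b => expR (x j / 2 * (-1) ^+ (b : bool)))).
    have -> : S / 3 = \sum_j 4 / 3 * (x j / 2) ^+ 2.
      by rewrite /S big_distrl /=; apply: eq_bigr => j _; rewrite -/(x j); field.
    rewrite expR_sum; apply: ler_prod => j _; rewrite avg_ge0 => [/=|b]; last exact: expR_ge0.
    apply: le_trans (cosh_le _); last first.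
      by rewrite normrM (ger0_norm (_ : 0 <= 2^-1 :> R)) ?invr_ge0 // -[leRHS]mul1r ler_pM2r ?invr_gt0.
    rewrite /avg card_bool big_bool /= !(expr0, expr1) mulr1 mulrN1 -mulrDr mulrC.
    by rewrite addrC.
  by move=> Y; rewrite expR_sum.
have lower : mu * expR (S / 2) <= avg (fun Y : {ffun 'I_n -> bool} => expR (\sum_j x j / 2 * (-1) ^+ Y j)).
  (* Tangent line of [expR] at [S / 2], the mean of the exponent on [A]; off [A] the lower bound is
     0. *)
  have -> : mu * expR (S / 2) = avg (fun Y : {ffun 'I_n -> bool} =>
      expR (S / 2) * ((1 - S / 2) * (A Y)%:R + \sum_j x j / 2 * ((A Y)%:R * (-1) ^+ Y j))).
    rewrite avgZ avgD avgZ avg_sum mulrC; congr (_ * _).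
    have -> : \sum_j avg (fun Y : {ffun 'I_n -> bool} => x j / 2 * ((A Y)%:R * (-1) ^+ Y j)) = S / 2 * mu.
      rewrite /S big_distrl big_distrl /=; apply: eq_bigr => j _.
      by rewrite avgZ -/(fourier1 A j) -/(x j) /x; field.
    by rewrite -/(density A) -/mu; ring.
  apply: ler_avg => Y; case: (A Y) => /=; last first.
    rewrite mulr0 add0r big1 ?mulr0 ?expR_ge0 // => j _.
    by rewrite mul0r mulr0.
  rewrite mulr1; under eq_bigr => j _ do rewrite mul1r.
  set Z := \sum_j x j / 2 * _.
  have -> : Z = S / 2 + (Z - S / 2) by ring.
  rewrite expRD ler_pM2l ?expR_gt0 //.
  by apply: le_trans (expR_ge1Dx _); lra.
have := le_trans lower upper.
have -> : S / 2 = S / 6 + S / 3 by field.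
rewrite expRD mulrA -[leRHS]mul1r ler_pM2r // expR_gt0 //.
Qed.

(** The concave function [mu * ln (1 / mu)] is replaced by its tangent at [mu = expR (- c)]: a bound
    linear in [mu] can be summed over transcripts. The factor [density A != 0] charges the constant
    term to nonempty sets only, and [leaves_count] bounds their number. *)
Lemma level_one_linear A (c : R) :
  \sum_j fourier1 A j ^+ 2 / density A <=
  6 * ((c - 1) * density A + expR (- c) * (density A != 0)%:R).
Proof.
have [->|mun0] := eqVneq (density A) 0.
  by rewrite big1 ?mulr0 ?addr0 ?mulr0 // => j _; rewrite invr0 mulr0.
have mu0 : 0 < density A by rewrite lt_def mun0 density_ge0.
have := level_one mu0; set S := \sum_j _ => H.
have -> : \sum_j fourier1 A j ^+ 2 / density A = density A * S.
  by rewrite /S big_distrr /=; apply: eq_bigr => j _; field.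
have : density A * (1 + (S / 6 - c)) <= density A * expR (S / 6 - c).
  by rewrite ler_pM2l // expR_ge1Dx.
have : density A * expR (S / 6 - c) <= expR (- c).
  by rewrite expRD mulrA -[leRHS]mul1r ler_pM2r // expR_gt0.
rewrite mulr1; lra.
Qed.

End LevelOne.

Lemma prod_natr_bool (R : comNzRingType) (I : finType) (b : I -> bool) :
  \prod_i (b i)%:R = [forall i, b i]%:R :> R.
Proof.
have [/forallP H|] := boolP [forall i, b i]; first by apply: big1 => i _; rewrite H.
rewrite negb_forall => /existsP[i /negbTE Hi].
by rewrite (bigD1 i) //= Hi mul0r.
Qed.

(** * Transcripts as rectangles *)

Section Leaves.
Variables (R : realType) (n k : nat).
Implicit Types (p : protocol n k) (X : input n k).

(* Output bit and rectangle of the inputs compatible with each transcript;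
   rectangles may be empty, transcripts being all paths in the tree. *)
Fixpoint leaves p : seq (bool * ('I_k -> pinput n -> bool)) :=
  match p with
  | Leaf b => [:: (b, fun _ _ => true)]
  | Node i f t0 t1 =>
      [seq (t.1, fun l x => ((l == i) ==> ~~ f x) && t.2 l x) | t <- leaves t0] ++
      [seq (t.1, fun l x => ((l == i) ==> f x) && t.2 l x) | t <- leaves t1]
  end.

(** [P] is all players in [leaves_pout] and all players but one in [leaves_count]. *)
Lemma forall_restrict (P : pred 'I_k) i (g : pinput n -> bool) (r : 'I_k -> pinput n -> bool) X :
  P i -> [forall l, P l ==> (((l == i) ==> g (X l)) && r l (X l))] =
  g (X i) && [forall l, P l ==> r l (X l)].
Proof.
move=> Pi; apply/forallP/andP => [H|[gi /forallP H] l].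
  split; first by have := H i; rewrite Pi eqxx /= => /andP[].
  by apply/forallP => l; have := H l; case: (P l) => //= /andP[].
have := H l; case: (P l) => //= ->; rewrite andbT.
by apply/implyP => /eqP ->.
Qed.

(** The rectangles partition the inputs, so exactly one term survives. *)
Lemma leaves_pout p X (phi : bool -> R) :
  \sum_(t <- leaves p) phi t.1 * [forall l, t.2 l (X l)]%:R = phi (pout p X).
Proof.
elim: p => [b|i f t0 IH0 t1 IH1] /=.
  rewrite big_seq1 /= (_ : [forall _, _] = true) ?mulr1 //; exact/forallP.
rewrite big_cat !big_map /=.
have E g (r : 'I_k -> pinput n -> bool) :
    [forall l, ((l == i) ==> g (X l)) && r l (X l)] = g (X i) && [forall l, r l (X l)].
  exact: (@forall_restrict predT).
case: ifP => fX.
  rewrite big1 ?add0r => [|t _]; last by rewrite (E (fun x => ~~ f x)) fX mulr0.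
  by rewrite -IH1; apply: eq_bigr => t _; rewrite E fX.
rewrite [X in _ + X]big1 ?addr0 => [|t _]; last by rewrite E fX mulr0.
by rewrite -IH0; apply: eq_bigr => t _; rewrite (E (fun x => ~~ f x)) fX.
Qed.

Definition update X i x : input n k := [ffun l => if l == i then x else X l].

(** With the other inputs fixed, only the nodes of player [i] branch. [S] holds the inputs of player
    [i] that reach the current node; it shrinks along the induction, so that the cost bound is
    required of live inputs only. *)
Lemma leaves_count p i X (S : pred (pinput n)) c :
  (forall x, S x -> pcost p (update X i x) i <= c)%N ->
  (\sum_(t <- leaves p) ([forall l, (l != i) ==> t.2 l (X l)]
      && [exists x, S x && t.2 i x]) <= 2 ^ c)%N.
Proof.
elim: p S c => [b|j f t0 IH0 t1 IH1] S c /= Hc.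
  by rewrite big_seq1 (leq_trans (leq_b1 _)) // expn_gt0.
rewrite big_cat !big_map /=; move: Hc; have [->|ji] := eqVneq j i => Hc.
  have E (g : pinput n -> bool) (t : bool * ('I_k -> pinput n -> bool)) :
     [forall l, (l != i) ==> (((l == i) ==> g (X l)) && t.2 l (X l))]
      && [exists x, S x && (g x && t.2 i x)] =
     [forall l, (l != i) ==> t.2 l (X l)] && [exists x, (S x && g x) && t.2 i x].
    congr (_ && _).
      by apply: eq_forallb => l; case: eqP.
    by apply: eq_existsb => x; rewrite andbA.
  have /= E0 := E (fun x => ~~ f x); under eq_bigr do rewrite E0.
  under [X in (_ + X <= _)%N]eq_bigr do rewrite (E f).
  (* If [c = 0], player [i] writes a bit here although none is allowed, so [S] is empty. *)
  case: c Hc => [|c] Hc.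
    have noS x : S x = false by apply/negP => /Hc.
    have Z (g : pinput n -> bool) (t : bool * ('I_k -> pinput n -> bool)) :
       [exists x, (S x && g x) && t.2 i x] = false.
      by apply/existsP => -[x]; rewrite noS.
    by rewrite !big1 // => t _; rewrite Z andbF.
  rewrite expnS mul2n -addnn leq_add ?IH0 ?IH1 // => x /andP[/Hc].
    by rewrite ffunE eqxx add1n ltnS => Hx /negbTE fx; rewrite fx in Hx.
  by rewrite ffunE eqxx add1n ltnS => Hx fx; rewrite fx in Hx.
(* Another player's bit is fixed by [X j], so one of the two subtrees contributes nothing. *)
have E (g : pinput n -> bool) (t : bool * ('I_k -> pinput n -> bool)) :
   [forall l, (l != i) ==> (((l == j) ==> g (X l)) && t.2 l (X l))]
    && [exists x, S x && ((false ==> g x) && t.2 i x)] =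
   g (X j) && ([forall l, (l != i) ==> t.2 l (X l)] && [exists x, S x && t.2 i x]).
  by rewrite (forall_restrict (P := fun l => l != i)) // -andbA.
have /= E0 := E (fun x => ~~ f x); under eq_bigr do rewrite E0.
under [X in (_ + X <= _)%N]eq_bigr do rewrite (E f).
have {}Hc x : S x -> (((if f (X j) then pcost t1 (update X i x) i
     else pcost t0 (update X i x) i)) <= c)%N.
  by move=> /Hc; rewrite ffunE (negbTE ji) add0n.
case: (f (X j)) Hc => Hc /=.
  by rewrite big1 // add0n; apply: IH1.
by rewrite [X in (_ + X)%N]big1 // addn0; apply: IH0.
Qed.

(** Expanding the product gives a sum over the choices of one input per player, and each choice lies
    in exactly one rectangle. The weights [m] are arbitrary to allow the mixed columns of
    [factor_mix]. *)
Lemma leaves_sum (T : finType) p (x : 'I_k -> T -> pinput n) (m : 'I_k -> T -> R) :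
  \sum_(t <- leaves p) \prod_l (\sum_w m l w * (t.2 l (x l w))%:R) =
  \prod_l \sum_w m l w.
Proof.
rewrite bigA_distr_bigA; under eq_bigr do rewrite bigA_distr_bigA.
rewrite exchange_big; apply: eq_bigr => Z _ /=.
under eq_bigr do rewrite big_split /= prod_natr_bool.
rewrite -big_distrr /= -[RHS]mulr1; congr (_ * _).
rewrite -[RHS](leaves_pout p [ffun l => x l (Z l)] (fun=> 1)); apply: eq_bigr => t _.
by rewrite mul1r; congr (_ *+ nat_of_bool _); apply: eq_forallb => l; rewrite ffunE.
Qed.

(** This controls the constant terms of [level_one_linear]: the other players' inputs are random,
    while player [i]'s side is only tested for emptiness. *)
Lemma leaves_avg_count (T : finType) p i c (x : 'I_k -> T -> pinput n) :
  (0 < #|T|)%N -> (forall X, pcost p X i <= c)%N ->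
  \sum_(t <- leaves p) [exists y, t.2 i y]%:R *
     \prod_(l | l != i) avg (fun w => (t.2 l (x l w))%:R : R) <= 2 ^+ c.
Proof.
move=> T0 Hc.
have E (t : bool * ('I_k -> pinput n -> bool)) :
   [exists y, t.2 i y]%:R * \prod_(l | l != i) avg (fun w => (t.2 l (x l w))%:R : R) =
   avg (fun Z : {ffun 'I_k -> T} => ([forall l, (l != i) ==> t.2 l (x l (Z l))]
      && [exists y, t.2 i y])%:R).
  (* The implication makes player [i]'s factor 1, so that [avg_prod] applies to all players. *)
  transitivity ([exists y, t.2 i y]%:R *
      \prod_l avg (fun w => ((l != i) ==> t.2 l (x l w))%:R : R)).
    congr (_ * _); rewrite big_mkcond; apply: eq_bigr => l _; case: eqP => //= _.
    by rewrite avg_const.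
  rewrite -avg_prod -avgZ; apply: eq_avg => Z.
  by rewrite prod_natr_bool mulrC -natrM mulnb.
under eq_bigr do rewrite E.
rewrite -avg_sum.
apply: le_trans (_ : avg (fun _ : {ffun 'I_k -> T} => 2 ^+ c) <= _); last first.
  by rewrite avg_const // card_ffun expn_gt0 T0.
apply: ler_avg => Z; rewrite -natr_sum -natrX ler_nat.
apply: leq_trans (leaves_count (p := p) (i := i) (X := [ffun l => x l (Z l)])
   (S := predT) (c := c) _) => [|y _]; last exact: Hc.
rewrite leq_eqVlt; apply/orP; left; apply/eqP; apply: eq_bigr => t _; congr (nat_of_bool (_ && _)).
by apply: eq_forallb => l; rewrite ffunE.
Qed.
End Leaves.

(** * Independence and single bits on the cube *)

Section Cube.
Variables (R : realType) (n : nat).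
Local Notation cube := {ffun 'I_n -> bool}.

Definition flip (Y Y' : cube) : cube := [ffun j => Y j (+) Y' j].

Lemma flip_inj Y : injective (flip Y).
Proof.
move=> Y1 Y2 /ffunP H; apply/ffunP => j.
by have := H j; rewrite !ffunE => /addbI.
Qed.

(* [Z] glues to [j |-> Z (W j) j], which is uniform when the [Z l] are
   independent and uniform: translate all of them by a common uniform [Y]. *)
Lemma avg_indep (k : nat) (W : 'I_n -> 'I_k) (F : 'I_k -> cube -> R) :
  (forall l (Y Y' : cube), (forall j, W j = l -> Y j = Y' j) -> F l Y = F l Y') ->
  avg (fun Y => \prod_l F l Y) = \prod_l avg (F l).
Proof.
move=> HF; rewrite -avg_prod; symmetry.
pose glue (Z : {ffun 'I_k -> cube}) : cube := [ffun j => Z (W j) j].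
pose G Y := \prod_l F l Y.
transitivity (avg (fun Z => G (glue Z))).
  apply: eq_avg => Z; apply: eq_bigr => l _; apply: HF => j <-.
  by rewrite ffunE.
pose shift Y (Z : {ffun 'I_k -> cube}) : {ffun 'I_k -> cube} := [ffun l => flip Y (Z l)].
have shift_inj Y : injective (shift Y).
  move=> Z1 Z2 /ffunP H; apply/ffunP => l; have := H l; rewrite !ffunE.
  exact: flip_inj.
transitivity (avg (fun Y => avg (fun Z => G (glue (shift Y Z))))).
  rewrite -[LHS](avg_const _ (ffun_bool_gt0 n)); apply: eq_avg => Y.
  by rewrite (avg_inj (fun Z => G (glue Z)) (@shift_inj Y)).
rewrite avg_exchange -[RHS](avg_const (T := {ffun 'I_k -> cube})); last first.
  by rewrite card_ffun expn_gt0 ffun_bool_gt0.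
apply: eq_avg => Z; rewrite -[RHS](avg_inj _ (@flip_inj (glue Z))).
apply: eq_avg => Y; congr G; apply/ffunP => j; rewrite !ffunE; exact: addbC.
Qed.

Definition set_bit j b (Y : cube) : cube := [ffun j' => if j' == j then b else Y j'].

Lemma avg_bit j (F : cube -> R) :
  avg F = 2^-1 * (avg (fun Y => F (set_bit j false Y)) + avg (fun Y => F (set_bit j true Y))).
Proof.
pose d : cube := [ffun j' => j' == j].
rewrite -avgD -avgZ.
transitivity (2^-1 * (avg F + avg (fun Y => F (flip d Y)))).
  by rewrite (avg_inj _ (@flip_inj d)); field.
rewrite -avgD -avgZ; apply: eq_avg => Y; congr (_ * _).
have E b : Y j = b -> set_bit j b Y = Y.
  by move=> Yj; apply/ffunP => j'; rewrite ffunE; case: eqP => // ->.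
have E' b : Y j = ~~ b -> set_bit j b Y = flip d Y.
  by move=> Yj; apply/ffunP => j'; rewrite !ffunE; case: eqP => // ->; rewrite Yj addTb negbK.
case Yj : (Y j); first by rewrite (E true) // (E' false) ?Yj // addrC.
by rewrite (E false) // (E' true) ?Yj.
Qed.
End Cube.

(** * Transcript laws with a distinguished column *)

Section Columns.
Variables (R : realType) (n k : nat).
Implicit Types (p : protocol n k) (W : {ffun 'I_n -> 'I_k}).
Local Notation cube := {ffun 'I_n -> bool}.
Local Notation leaf := (bool * ('I_k -> pinput n -> bool))%type.

Definition column W (j : 'I_n) (b : bool) (l : 'I_k) (Y : cube) : pinput n :=
  [ffun j' => if j' == j then b else (W j' == l) && Y j'].

(* Player [l]'s factor of the probability of a transcript, when column [j] is
   [b] for player [l] and the other columns are drawn from [W]. *)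
Definition factor W j b (t : leaf) l : R := avg (fun Y => (t.2 l (column W j b l Y))%:R).

(* Half the triangular discrimination between [P_0] and [P_{i}]: it bounds their
   squared Hellinger distance and does not depend on [W j]. *)
Definition disc p W j i : R :=
  \sum_(t <- leaves p) (\prod_(l | l != i) factor W j false t l) *
    (2^-1 * ((factor W j false t i - factor W j true t i) ^+ 2
             / (factor W j false t i + factor W j true t i))).

Lemma factor_ge0 W j b t l : 0 <= factor W j b t l.
Proof. by apply: avg_ge0 => Y; apply: ler0n. Qed.

(** Given [W], the players read disjoint sets of bits of [Y], so their sides of a rectangle are
    independent events. *)
Lemma avg_pout_column p W j b (phi : bool -> R) :
  avg (fun Y => phi (pout p [ffun l => column W j b l Y])) =
  \sum_(t <- leaves p) phi t.1 * \prod_l factor W j b t l.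
Proof.
under eq_avg do rewrite -(leaves_pout p _ phi).
rewrite avg_sum; apply: eq_bigr => t _; rewrite avgZ; congr (_ * _).
rewrite -(avg_indep (W := W)) => [|l Y Y' YY'].
  apply: eq_avg => Y; rewrite prod_natr_bool.
  by congr (_ *+ nat_of_bool _); apply: eq_forallb => l; rewrite ffunE.
congr (_ *+ nat_of_bool (t.2 l _)); apply/ffunP => j'; rewrite !ffunE.
by case: eqP => // _; case: eqP => //= /YY' ->.
Qed.

(** Let each player [l] independently put 1 in column [j] with probability [x l]; the transcript of
    this random input has a probability law. This is the hypothesis [mix1]. *)
Lemma factor_mix p W j (x : 'I_k -> R) :
  \sum_(t <- leaves p) \prod_l ((1 - x l) * factor W j false t l + x l * factor W j true t l) = 1.
Proof.
pose m l (w : bool * cube) : R := (if w.1 then x l else 1 - x l) * #|cube|%:R^-1.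
transitivity (\prod_(l < k) \sum_w m l w).
  rewrite -(leaves_sum p (fun l w => column W j w.1 l w.2)).
  apply: eq_bigr => t _; apply: eq_bigr => l _.
  rewrite -(pair_bigA _ (fun b Y => m l (b, Y) * (t.2 l (column W j b l Y))%:R)) /=.
  rewrite big_bool /= /factor /avg !big_distrr addrC /=.
  by congr (_ + _); apply: eq_bigr => Y _; rewrite /m /= mulrA.
apply: big1 => l _.
rewrite -(pair_bigA _ (fun b Y => m l (b, Y))) /= big_bool /=.
rewrite -!big_distrr /= -mulrDl addrC subrK mul1r.
by rewrite sum_avg_weight ?ffun_bool_gt0.
Qed.

Lemma sqrtB_sqr_le (a b : R) : 0 <= a -> 0 <= b ->
  (Num.sqrt a - Num.sqrt b) ^+ 2 <= (a - b) ^+ 2 / (a + b).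
Proof.
move=> a0 b0; have := sqr_sqrtr a0; have := sqr_sqrtr b0.
have := sqrtr_ge0 a; have := sqrtr_ge0 b.
move: (Num.sqrt a) (Num.sqrt b) => u v v0 u0 vb ua.
(* If [a + b = 0], the quotient is 0 by convention and both roots vanish. *)
have [ab|ab] := eqVneq (a + b) 0.
  have uv : u ^+ 2 + v ^+ 2 = 0 by rewrite ua vb.
  rewrite ab invr0 mulr0; nra.
rewrite ler_pdivlMr ?lt_def ?ab ?addr_ge0 // -ua -vb.
have -> : (u ^+ 2 - v ^+ 2) ^+ 2 = (u - v) ^+ 2 * (u + v) ^+ 2 by ring.
rewrite ler_wpM2l ?sqr_ge0 //; nra.
Qed.

(** If errors are rare, P_0 and P_[k] concentrate on different outputs, so their Bhattacharyya
    coefficient [BC] is small; [hell_product_le] bounds [1 - BC] by the one-player distances. *)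
Lemma disc_ge_error p W j :
  3 / 4 - 2 * (avg (fun Y => (pout p [ffun l => column W j false l Y])%:R)
             + avg (fun Y => (~~ pout p [ffun l => column W j true l Y])%:R))
  <= 4 * \sum_i disc p W j i.
Proof.
rewrite (avg_pout_column p W j false (fun b => b%:R)).
rewrite (avg_pout_column p W j true (fun b => (~~ b)%:R)).
set e0 := \sum_(t <- _) _; set e1 := \sum_(t <- _) _.
have HBC := @hell_product_le R _ k (leaves p) (factor W j false) (factor W j true)
  (factor_ge0 W j false) (factor_ge0 W j true) (factor_mix p W j).
set H := \sum_(i < k) _ in HBC; set BC := \sum_(t <- leaves p) _ in HBC.
have HD : H <= 2 * \sum_i disc p W j i.
  rewrite big_distrr /=; apply: ler_sum => i _; rewrite big_distrr /=.
  apply: ler_sum => t _; rewrite [leRHS]mulrCA ler_wpM2l //.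
    by apply: prodr_ge0 => l _; exact: factor_ge0.
  by rewrite [leRHS]mulrA mulfV ?pnatr_eq0 // mul1r sqrtB_sqr_le ?factor_ge0.
have sum1 b : \sum_(t <- leaves p) \prod_l factor W j b t l = 1.
  rewrite -[RHS](factor_mix p W j (fun=> b%:R)); apply: eq_bigr => t _; apply: eq_bigr => l _.
  by case: b; rewrite /= ?subrr ?subr0 ?mul0r ?mul1r ?add0r ?addr0.
(* Use [u * v <= 2 * u^2 + v^2 / 8], the weight 2 going to the law for which the transcript's output
   is wrong; each 1/8 multiplies a total mass 1. *)
have : BC <= 2 * (e0 + e1) + (8^-1 + 8^-1).
  have -> : 8^-1 + 8^-1 = 8^-1 * (\sum_(t <- leaves p) \prod_l factor W j false t l)
     + 8^-1 * (\sum_(t <- leaves p) \prod_l factor W j true t l) by rewrite !sum1 mulr1.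
  rewrite /e0 /e1 mulrDr !big_distrr -!big_split /=; apply: ler_sum => t _.
  rewrite big_split /=.
  have sq b : (\prod_l Num.sqrt (factor W j b t l)) ^+ 2 = \prod_l factor W j b t l.
    by rewrite -prodrXl; apply: eq_bigr => l _; rewrite sqr_sqrtr ?factor_ge0.
  rewrite -!sq.
  set u := \prod_l Num.sqrt _; set v := \prod_l Num.sqrt _.
  have := sqr_ge0 (4 * u - v); have := sqr_ge0 (4 * v - u).
  have := sqr_ge0 u; have := sqr_ge0 v.
  case: t.1 => /=; nra.
lra.
Qed.

(** * Discrimination summed over columns and averaged over [W] *)

Lemma expN_pow2_le1 c : expR (- c%:R) * 2 ^+ c <= 1 :> R.
Proof.
rewrite expRN -[c%:R]mulr1 expRM_natl mulrC ler_pdivrMr ?exprn_gt0 ?expR_gt0 // mul1r.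
by rewrite lerXn2r ?nnegrE ?expR_ge0 // (le_trans _ (expR_ge1Dx 1)).
Qed.

Lemma disc_ge0 p W j i : 0 <= disc p W j i.
Proof.
apply: sumr_ge0 => t _; apply: mulr_ge0.
  by apply: prodr_ge0 => l _; exact: factor_ge0.
apply: mulr_ge0; first by rewrite invr_ge0.
by rewrite divr_ge0 ?sqr_ge0 // addr_ge0 // factor_ge0.
Qed.

(** When [W j = i], the other players hold 0 in column [j] anyway and [Y j] is player [i]'s bit
    there, so each term of [disc] is a level-one quantity of player [i]'s side. Then
    [level_one_linear] gives [6 * (c - 1)] from total mass 1, and at most
    [6 * expR (- c) * 2 ^ c <= 6] from the nonempty sides. *)
Lemma disc_sum_le p W i c : (forall X, pcost p X i <= c)%N ->
  \sum_(j | W j == i) disc p W j i <= 6 * c%:R.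
Proof.
move=> Hc.
pose mu (t : leaf) l : R := avg (fun Y => (t.2 l (X0 W Y l))%:R).
pose S (t : leaf) : pred cube := fun Y => t.2 i (X0 W Y i).
have muE t : mu t i = density R (S t) by [].
have mu0 t l : 0 <= mu t l by apply: avg_ge0 => Y; apply: ler0n.
have discE j : W j = i -> disc p W j i = \sum_(t <- leaves p)
    (\prod_(l | l != i) mu t l) * (fourier1 R (S t) j ^+ 2 / density R (S t)).
  move=> Wj.
  have colE b Y : column W j b i Y = X0 W (set_bit j b Y) i.
    by apply/ffunP => j'; rewrite !ffunE; case: eqP => // ->; rewrite Wj eqxx.
  have facE b t : factor W j b t i = avg (fun Y => (S t (set_bit j b Y))%:R).
    by apply: eq_avg => Y; rewrite colE.
  apply: eq_bigr => t _; congr (_ * _).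
    apply: eq_bigr => l li; apply: eq_avg => Y; congr (_ *+ nat_of_bool (t.2 l _)).
    apply/ffunP => j'; rewrite !ffunE; case: eqP => // ->.
    by rewrite Wj eq_sym (negbTE li).
  have -> : density R (S t) = 2^-1 * (factor W j false t i + factor W j true t i).
    by rewrite !facE /density (avg_bit j).
  have -> : fourier1 R (S t) j = 2^-1 * (factor W j false t i - factor W j true t i).
    rewrite !facE /fourier1 (avg_bit j) -[- avg _]mulN1r -avgZ; congr (_ * (_ + _)).
      by apply: eq_avg => Y; rewrite [set_bit _ _ _ j]ffunE eqxx expr0 mulr1.
    by apply: eq_avg => Y; rewrite [set_bit _ _ _ j]ffunE eqxx expr1 mulrC.
  have [->|s0] := eqVneq (factor W j false t i + factor W j true t i) 0.
    by rewrite mulr0 invr0 !mulr0.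
  by field.
rewrite (eq_bigr (fun j => \sum_(t <- leaves p)
    (\prod_(l | l != i) mu t l) * (fourier1 R (S t) j ^+ 2 / density R (S t)))); last first.
  by move=> j /eqP /discE.
(* The columns with [W j != i] are added back: their terms are nonnegative, and the level-one
   inequality runs over all coordinates. *)
apply: le_trans (_ : \sum_j \sum_(t <- leaves p)
    (\prod_(l | l != i) mu t l) * (fourier1 R (S t) j ^+ 2 / density R (S t)) <= _).
  rewrite big_mkcond /=; apply: ler_sum => j _; case: ifP => // _.
  apply: sumr_ge0 => t _; rewrite mulr_ge0 ?prodr_ge0 // divr_ge0 ?sqr_ge0 //.
  exact: density_ge0.
rewrite exchange_big /=; under eq_bigr do rewrite -big_distrr /=.
have T1 : \sum_(t <- leaves p) \prod_l mu t l = 1.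
  rewrite (leaves_sum p (fun l Y => X0 W Y l) (fun _ _ => #|cube|%:R^-1)).
  apply: big1 => l _.
  by rewrite sum_avg_weight ?ffun_bool_gt0.
have T2 := leaves_avg_count R (p := p) (i := i) (c := c) (fun l Y => X0 W Y l)
   (ffun_bool_gt0 n) Hc.
apply: le_trans (_ : \sum_(t <- leaves p) (6 * (c%:R - 1) * \prod_l mu t l +
   6 * expR (- c%:R) * ([exists y, t.2 i y]%:R * \prod_(l | l != i) mu t l)) <= _).
  apply: ler_sum => t _.
  apply: le_trans (ler_wpM2l _ (level_one_linear (S t) c%:R)) _; first exact: prodr_ge0.
  rewrite [X in _ <= _ * X + _](bigD1 i) //= muE.
  have : (density R (S t) != 0)%:R <= [exists y, t.2 i y]%:R :> R.
    rewrite ler_nat; case: (boolP [exists y, t.2 i y]) => [_|]; first exact: leq_b1.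
    rewrite negb_exists => /forallP noy.
    rewrite /density /avg big1 ?eqxx // => Y _.
    by rewrite /S (negbTE (noy _)) mulr0.
  set P := \prod_(l | _) _; set e := expR _; set d := density _ _.
  move=> H; have : P * e * (d != 0)%:R <= P * e * [exists y, t.2 i y]%:R.
    by rewrite ler_wpM2l // mulr_ge0 ?expR_ge0 ?prodr_ge0.
  lra.
rewrite big_split /= -!big_distrr /= T1 mulr1.
have := expN_pow2_le1 c; have : expR (- c%:R) * \sum_(t <- leaves p) [exists y, t.2 i y]%:R *
     \prod_(l | l != i) mu t l <= expR (- c%:R) * 2 ^+ c by rewrite ler_wpM2l ?expR_ge0.
lra.
Qed.

(** [W j] is independent of [G W]: an extra sample from [nu] is swapped with [W j], which preserves
    the product weight. *)
Lemma resample (nu : 'I_k -> R) (j : 'I_n) i (G : {ffun 'I_n -> 'I_k} -> R) :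
  \sum_l nu l = 1 ->
  (forall W W', (forall j', j' != j -> W j' = W' j') -> G W = G W') ->
  \sum_(W : {ffun 'I_n -> 'I_k}) (\prod_j' nu (W j')) * ((W j == i)%:R * G W) =
  nu i * \sum_(W : {ffun 'I_n -> 'I_k}) (\prod_j' nu (W j')) * G W.
Proof.
move=> nu1 HG.
pose w (W : {ffun 'I_n -> 'I_k}) := \prod_(j' < n) nu (W j').
pose sw (u : {ffun 'I_n -> 'I_k} * 'I_k) : {ffun 'I_n -> 'I_k} * 'I_k :=
  ([ffun j' => if j' == j then u.2 else u.1 j'], u.1 j).
have swK : involutive sw.
  move=> [W l]; congr (_, _) => /=; last by rewrite ffunE eqxx.
  by apply/ffunP => j'; rewrite !ffunE; case: eqP => // ->.
have wsw u : w (sw u).1 * nu (sw u).2 = w u.1 * nu u.2.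
  rewrite /w (bigD1 j) //= [in RHS](bigD1 j) //= ffunE eqxx.
  rewrite (eq_bigr (fun j' => nu (u.1 j'))); first by ring.
  by move=> j' /negbTE jj'; rewrite ffunE jj'.
transitivity (\sum_u w u.1 * nu u.2 * ((u.1 j == i)%:R * G u.1)).
  rewrite -(pair_bigA _ (fun W l => w W * nu l * ((W j == i)%:R * G W))) /=.
  apply: eq_bigr => W _; rewrite -big_distrl -big_distrr /=.
  by rewrite nu1 mulr1.
rewrite (reindex_inj (inv_inj swK)).
transitivity (\sum_u w u.1 * nu u.2 * ((u.2 == i)%:R * G u.1)).
  apply: eq_bigr => u _; rewrite wsw; congr (_ * (_ * _)).
    by rewrite /= ffunE eqxx.
  by apply: HG => j' /negbTE jj'; rewrite ffunE jj'.
rewrite -(pair_bigA _ (fun W l => w W * nu l * ((l == i)%:R * G W))) /= big_distrr /=.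
apply: eq_bigr => W _; rewrite (bigD1 i) //= eqxx big1 ?addr0 => [|l /negbTE ->].
  by rewrite /w mul1r; ring.
by rewrite mul0r mulr0.
Qed.

Lemma disc_local p j i W W' : (forall j', j' != j -> W j' = W' j') ->
  disc p W j i = disc p W' j i.
Proof.
move=> WW'; have E b t l : factor W j b t l = factor W' j b t l.
  apply: eq_avg => Y; congr (_ *+ nat_of_bool (t.2 l _)).
  by apply/ffunP => j'; rewrite !ffunE; case: eqP => // /eqP /WW' ->.
apply: eq_bigr => t _; rewrite !E; congr (_ * _).
by apply: eq_bigr => l _; rewrite E.
Qed.

Lemma sum_disc_le (nu : 'I_k -> R) p i c :
  (forall l, 0 <= nu l) -> \sum_l nu l = 1 -> (forall X, pcost p X i <= c)%N ->
  (nu i = 0 -> c = 0%N) ->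
  \sum_(W : {ffun 'I_n -> 'I_k}) (\prod_j nu (W j)) * (\sum_j disc p W j i)
    <= 6 * (if nu i != 0 then c%:R / nu i else 0).
Proof.
move=> nu0 nu1 Hc c0.
have w0 (W : {ffun 'I_n -> 'I_k}) : 0 <= \prod_j nu (W j) by exact: prodr_ge0.
(* If [nu i = 0] then [c = 0]; moving [W j] to [i] leaves [disc] unchanged, and [disc_sum_le] bounds
   it by 0. *)
have [nui|nui] /= := eqVneq (nu i) 0.
  rewrite mulr0; apply: sumr_le0 => W _; rewrite mulr_ge0_le0 //.
  apply: sumr_le0 => j _.
  pose W' : {ffun 'I_n -> 'I_k} := [ffun j' => if j' == j then i else W j'].
  rewrite (@disc_local p j i W W'); last by move=> j' /negbTE jj'; rewrite ffunE jj'.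
  have := disc_sum_le W' Hc; rewrite c0 // mulr0; apply: le_trans.
  rewrite (bigD1 j) /= ?ffunE ?eqxx // lerDl.
  by apply: sumr_ge0 => j' _; exact: disc_ge0.
have nuip : 0 < nu i by rewrite lt_def nui nu0.
rewrite -(ler_pM2l nuip).
have -> : nu i * (6 * (c%:R / nu i)) = 6 * c%:R by field.
have -> : nu i * (\sum_(W : {ffun 'I_n -> 'I_k}) (\prod_j nu (W j)) * (\sum_j disc p W j i)) =
  \sum_(W : {ffun 'I_n -> 'I_k}) (\prod_j nu (W j)) * (\sum_(j | W j == i) disc p W j i).
  under eq_bigr do rewrite big_distrr /=.
  under [RHS]eq_bigr do rewrite big_distrr big_mkcond /=.
  rewrite exchange_big [RHS]exchange_big big_distrr /=; apply: eq_bigr => j _.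
  rewrite -(@resample nu j i (fun W => disc p W j i) nu1 (@disc_local p j i)).
  by apply: eq_bigr => W _; case: ifP => _; rewrite ?mul1r ?mul0r ?mulr0.
have W1 : \sum_(W : {ffun 'I_n -> 'I_k}) \prod_j nu (W j) = 1.
  by rewrite -(bigA_distr_bigA (fun _ => nu)) big1.
rewrite -[leRHS]mul1r -[X in _ <= X * _]W1 big_distrl /=; apply: ler_sum => W _.
by rewrite ler_wpM2l // disc_sum_le.
Qed.

End Columns.

(** * From the success probability to the cost bound *)

Theorem mainTheorem4 :
  exists c : Rr, 0 < c /\
  forall (n k : nat) (nu : 'I_k -> Rr) (cb : 'I_k -> nat) (p : protocol n k),
    (1 <= n)%N -> (2 <= k)%N -> is_distr nu ->
    bounded p cb ->
    1 - 2%:R / 100%:R <= success_prob nu p ->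
    (* sum_i c_i / nu(i) >= c n, with 0/0 = 0 and a/0 = +oo for a > 0 *)
    (exists i : 'I_k, nu i = 0 /\ (0 < cb i)%N) \/
    c * n%:R <= \sum_(i < k | nu i != 0) (cb i)%:R / nu i.
Proof.
(* The proof ends with [59/100 * n <= 24 * C], where 24 is 4 from [disc_ge_error] times 6 from
   [sum_disc_le], and 59/2400 exceeds 1/50. *)
exists 50^-1; split; first by rewrite invr_gt0 ltr0n.
move=> n k nu cb p n0 _ [nu0 nu1] Hb Hs.
have [/existsP[i /andP[/eqP nui ci]]|] := boolP [exists i, (nu i == 0) && (0 < cb i)%N].
  by left; exists i.
rewrite negb_exists => /forallP Hi; right.
have c0 i : nu i = 0 -> cb i = 0%N.
  by move=> /eqP nui; have := Hi i; rewrite nui /= -eqn0Ngt => /eqP.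
pose w (W : {ffun 'I_n -> 'I_k}) : Rr := \prod_j nu (W j).
have w0 W : 0 <= w W by exact: prodr_ge0.
have w1 : \sum_W w W = 1 by rewrite /w -(bigA_distr_bigA (fun _ => nu)) big1.
have nn0 : n%:R != 0 :> Rr by rewrite pnatr_eq0 -lt0n.
pose cube := {ffun 'I_n -> bool}.
have cardc : (#|cube|%:R : Rr) = 2 ^+ n by rewrite card_ffun card_bool card_ord natrX.
pose e0 (W : {ffun 'I_n -> 'I_k}) : Rr := avg (fun Y => (pout p (X0 W Y))%:R).
pose e1 (W : {ffun 'I_n -> 'I_k}) j : Rr := avg (fun Y => (~~ pout p (X1 W Y j))%:R).
have avgN (f : cube -> bool) : avg (fun Y => (~~ f Y)%:R : Rr) = 1 - avg (fun Y => (f Y)%:R).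
  apply/eqP; rewrite eq_sym subr_eq -avgD; apply/eqP.
  rewrite -[LHS](avg_const _ (ffun_bool_gt0 n)); apply: eq_avg => Y.
  by case: (f Y); rewrite ?add0r ?addr0.
have s0 : \sum_W \sum_Y wWY nu W Y * (~~ pout p (X0 W Y))%:R = 1 - \sum_W w W * e0 W.
  rewrite -[X in X - _]w1 -sumrB; apply: eq_bigr => W _.
  transitivity (w W * avg (fun Y => (~~ pout p (X0 W Y))%:R)).
    rewrite /avg big_distrr /=; apply: eq_bigr => Y _.
    by rewrite cardc mulrA.
  by rewrite avgN mulrBr mulr1.
have s1 : \sum_W \sum_Y \sum_(j < n) wWY nu W Y * n%:R^-1 * (pout p (X1 W Y j))%:R =
    1 - n%:R^-1 * \sum_W w W * \sum_j e1 W j.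
  rewrite -[X in X - _]w1 big_distrr -sumrB; apply: eq_bigr => W _ /=.
  transitivity (w W * (n%:R^-1 * \sum_j (1 - e1 W j))).
    rewrite exchange_big !big_distrr /=; apply: eq_bigr => j _.
    have -> : 1 - e1 W j = avg (fun Y => (pout p (X1 W Y j))%:R).
      by rewrite /e1 avgN opprB addrC subrK.
    rewrite /avg !big_distrr /=; apply: eq_bigr => Y _.
    by rewrite cardc /wWY -/(w W); ring.
  by rewrite sumrB sumr_const card_ord; field.
have key W : n%:R * (3 / 4) - 2 * (n%:R * (2 * e0 W) + \sum_j e1 W j)
    <= 4 * \sum_i \sum_j disc Rr p W j i.
  have kj j : 3 / 4 - 2 * (2 * e0 W + e1 W j) <= 4 * \sum_i disc Rr p W j i.
    apply: le_trans (disc_ge_error Rr p W j).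
    have -> : avg (fun Y => (~~ pout p [ffun l => column W j true l Y])%:R) = e1 W j.
      by apply: eq_avg.
    (* Zeroing column [j] amounts to conditioning on [Y j = false], of probability 1/2, so the error
       at most doubles. *)
    suff : avg (fun Y => (pout p [ffun l => column W j false l Y])%:R) <= 2 * e0 W by lra.
    rewrite /e0 [X in _ <= _ * X](avg_bit j) mulrA mulfV ?pnatr_eq0 // mul1r.
    rewrite (_ : avg _ = avg (fun Y => (pout p (X0 W (set_bit j false Y)))%:R)).
      by rewrite lerDl avg_ge0 // => Y; apply: ler0n.
    apply: eq_avg => Y; congr (_ *+ nat_of_bool (pout p _)).
    apply/ffunP => l; rewrite !ffunE; apply/ffunP => j'; rewrite !ffunE.
    by case: eqP => // _; rewrite andbF.
  rewrite [X in _ <= _ * X]exchange_big [leRHS]big_distrr /=.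
  apply: le_trans (_ : \sum_(j < n) (3 / 4 - 2 * (2 * e0 W + e1 W j)) <= _).
    rewrite sumrB -[X in _ <= _ - X]big_distrr big_split /= !sumr_const card_ord.
    by rewrite -[X in _ <= X - _]mulr_natl -[X in _ <= _ - _ * (X + _)]mulr_natl.
  by apply: ler_sum => j _; exact: kj.
have main : n%:R * (3 / 4) - 2 * (n%:R * (2 * \sum_W w W * e0 W) + \sum_W w W * \sum_j e1 W j)
   <= 24 * \sum_(i < k | nu i != 0) (cb i)%:R / nu i.
  apply: le_trans (_ : \sum_W w W * (4 * \sum_i \sum_j disc Rr p W j i) <= _).
    apply: le_trans (_ : \sum_W w W * (n%:R * (3 / 4)
         - 2 * (n%:R * (2 * e0 W) + \sum_j e1 W j)) <= _).
      rewrite -[X in X - _]mul1r -[X in X * _ - _]w1 !big_distrl !big_distrr -big_split /=.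
      rewrite big_distrr -sumrB /=; apply: ler_sum => W _.
      by rewrite le_eqVlt; apply/orP; left; apply/eqP; ring.
    by apply: ler_sum => W _; rewrite ler_wpM2l.
  under eq_bigr do rewrite mulrCA big_distrr /=.
  rewrite -big_distrr exchange_big /= [X in _ <= _ * X]big_mkcond /=.
  have -> : 24 = 4 * 6 :> Rr by ring.
  rewrite -mulrA ler_wpM2l // big_distrr /=; apply: ler_sum => i _.
  exact: sum_disc_le nu0 nu1 (fun X => Hb X i) (c0 i).
move: Hs main; rewrite /success_prob s0 s1.
set a := \sum_W _; set b := \sum_W _ * \sum_j _; set C := \sum_(i | _) _.
have b0 : 0 <= n%:R^-1 * b.
  rewrite mulr_ge0 ?invr_ge0 //; apply: sumr_ge0 => W _; rewrite mulr_ge0 //.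
  by apply: sumr_ge0 => j _; apply: avg_ge0 => Y; apply: ler0n.
have bE : b = n%:R * (n%:R^-1 * b) by rewrite mulrA mulfV // mul1r.
rewrite {2}bE; move: (n%:R^-1 * b) b0 => B B0 {bE} H1 H2.
have n1 : 0 < n%:R :> Rr by rewrite ltr0n.
have : n%:R * (3 / 4 - 4 * a - 2 * B) <= 24 * C by move: H2; lra.
(* Success gives [a + B <= 4/100], hence [4 * a + 2 * B <= 16/100] as [B >= 0], and 3/4 - 16/100 =
   59/100. *)
have : n%:R * (59 / 100) <= n%:R * (3 / 4 - 4 * a - 2 * B) by rewrite ler_pM2l //; lra.
lra.
Qed.
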